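(* For any $n\ge1$, the funny product $\square$ of generalised $n$-disks endows the category $\mathrm{GDisk}_n$ of generalised $n$-disks with a symmetric monoidal structure. Its unit is the degenerate $n$-disk (the one all of whose level sets $X_0,\dots,X_n$ are singletons).
   Context: In a small category $C$, a (generalised) minimum is an object which is not the target of any non-identity arrow, and a (generalised) maximum is an object which is not the source of any non-identity arrow. A generalised interval is a connected small category with a unique minimum and a unique maximum, which are distinct objects except when the category is the final category (the degenerate generalised interval). A generalised $n$-disk $X$ consists of sets $X_0,\dots,X_n$ and maps $i_k:X_{k+1}\to X_k$, $s_k,t_k:X_k\to X_{k+1}$ ($0\le k\le n-1$) with $s_{k+1}s_k=t_{k+1}s_k$, $s_{k+1}t_k=t_{k+1}t_k$, $i_ks_k=i_kt_k=\mathrm{id}$, such that $X_0$ is a singleton, and for each $x\in X_k$ the set $i_k^{-1}(x)\subset X_{k+1}$ has the structure of (the object set of) a generalised interval whose generalised minimum and generalised maximum are $s_k(x)$ and $t_k(x)$, respectively. The generalised interval $i_k^{-1}(x)$ is degenerate (if and) only if $x\in\partial X_{k-1}$, where $\partial X_{k-1}:=s_{k-1}(X_{k-1})\cup t_{k-1}(X_{k-1})\subset X_k$. A morphism $f:X\to Y$ of generalised $n$-disks is a family of maps $f_k:X_k\to Y_k$ commuting with all $i_k,s_k,t_k$, whose restriction to the fibres $i_k^{-1}(x)\to i_k^{-1}(f_k(x))$ is a functor, for any $x\in X_k$. The category of generalised $n$-disks is denoted by $\mathrm{GDisk}_n$. The funny product $C\square D$ of small categories has object set $\mathrm{Ob}(C)\times\mathrm{Ob}(D)$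 and morphisms generated by $f\square\mathrm{id}_d:(c_1,d)\to(c_2,d)$ and $\mathrm{id}_c\square g:(c,d_1)\to(c,d_2)$ for $f:c_1\to c_2$ in $C$, $g:d_1\to d_2$ in $D$, with only relations $(f_2\square\mathrm{id}_d)\circ(f_1\square\mathrm{id}_d)=f_2f_1\square\mathrm{id}_d$ and $(\mathrm{id}_c\square g_2)\circ(\mathrm{id}_c\square g_1)=\mathrm{id}_c\square g_2g_1$; the interchange relation $(\mathrm{id}_{c_2}\times g)\circ(f\times\mathrm{id}_{d_1})=(f\times\mathrm{id}_{d_2})\circ(\mathrm{id}_{c_1}\times g)$, which holds in $C\times D$, is not imposed. For generalised $n$-disks $X,Y$, the funny product $X\square Y$ is the generalised $n$-disk with underlying sets $(X\square Y)_k=X_k\times Y_k$, with componentwise structure maps, such that the generalised interval structure on the fibre over $(x,y)$ is the funny product of the corresponding generalised intervals: $i_k^{-1}(x,y)=i_k^{-1}(x)\square i_k^{-1}(y)$.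
   Formalization: Disks are not required to have degenerate fibres only over boundary points (the ''only if'' is dropped; ''if'' is kept), since for n ≥ 2 the funny product of such disks has degenerate fibres over non-boundary corners like (s,t), and the unit would fail it at level 0. *)

(* Defs.v *)
(* Sets are types: equality proofs in them are irrelevant, functions are
   extensional, and quotients are types of equivalence classes. *)
From mathcomp Require Import all_boot.
From mathcomp Require Import boolp.

Set Implicit Arguments.
Unset Strict Implicit.
Unset Printing Implicit Defensive.

(* Unbundled: "the structure of a category with object set T". *)
Record category (T : Type) := Category {
  hom : T -> T -> Type;
  idm : forall a, hom a a;
  comp : forall a b c, hom b c -> hom a b -> hom a c;
  comp_idl : forall a b (f : hom a b), comp (idm b) f = f;
  comp_idr : forall a b (f : hom a b), comp f (idm a) = f;
  comp_assoc : forall a b c d (h : hom c d) (g : hom b c) (f : hom a b),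
    comp h (comp g f) = comp (comp h g) f }.
Arguments hom {T} C a b : rename.
Arguments idm {T} C a : rename.
Arguments comp {T} C {a b c} g f : rename.

Record functor S T (C : category S) (D : category T) := Functor {
  fob :> S -> T;
  farr : forall a b, hom C a b -> hom D (fob a) (fob b);
  farr_id : forall a, farr (idm C a) = idm D (fob a);
  farr_comp : forall a b c (g : hom C b c) (f : hom C a b),
    farr (comp C g f) = comp D (farr g) (farr f) }.
Arguments farr {S T C D} F {a b} f : rename.

Lemma functor_eq S T (C : category S) (D : category T) (o : S -> T)
    (r : forall a b, hom C a b -> hom D (o a) (o b)) p p' q q' :
  @Functor S T C D o r p q = @Functor S T C D o r p' q'.
Proof. by rewrite (Prop_irrelevance p p') (Prop_irrelevance q q'). Qed.

Definition functor_id S (C : category S) : functor C C :=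
  @Functor S S C C id (fun a b f => f) (fun=> erefl) (fun _ _ _ _ _ => erefl).

Section FunctorComp.
Variables (S T U : Type) (C : category S) (D : category T) (E : category U).
Variables (G : functor D E) (F : functor C D).

Fact functor_comp_id a : farr G (farr F (idm C a)) = idm E (G (F a)).
Proof. by rewrite !farr_id. Qed.

Fact functor_comp_comp a b c (g : hom C b c) (f : hom C a b) :
  farr G (farr F (comp C g f)) = comp E (farr G (farr F g)) (farr G (farr F f)).
Proof. by rewrite !farr_comp. Qed.

Definition functor_comp : functor C E :=
  @Functor S U C E (fun a => G (F a)) (fun a b f => farr G (farr F f))
    functor_comp_id functor_comp_comp.

End FunctorComp.

Inductive is_identity T (C : category T) : forall a b, hom C a b -> Prop :=
  IsIdentity a : is_identity (idm C a).

Definition minimum T (C : category T) (m : T) : Prop :=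
  forall a (f : hom C a m), is_identity f.

Definition maximum T (C : category T) (m : T) : Prop :=
  forall b (f : hom C m b), is_identity f.

Inductive zigzag T (C : category T) (a : T) : T -> Prop :=
| zz_refl : zigzag C a a
| zz_fwd b c of zigzag C a b & hom C b c : zigzag C a c
| zz_bwd b c of zigzag C a b & hom C c b : zigzag C a c.

Definition connected T (C : category T) : Prop :=
  inhabited T /\ forall a b, zigzag C a b.

Definition final T (C : category T) : Prop :=
  (exists! a : T, True) /\ forall a b, exists! f : hom C a b, True.

Record gen_interval T (C : category T) (m M : T) : Prop := GenInterval {
  gi_connected : connected C;
  gi_min : forall a, minimum C a <-> a = m;
  gi_max : forall a, maximum C a <-> a = M;
  gi_final : m = M -> final C }.

Section Funny.
Variables (S T : Type) (C : category S) (D : category T).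

Inductive fterm : S * T -> S * T -> Type :=
| fid u : fterm u u
| fcomp u v w of fterm v w & fterm u v : fterm u w
| finl c1 c2 (f : hom C c1 c2) d : fterm (c1, d) (c2, d)
| finr c d1 d2 (g : hom D d1 d2) : fterm (c, d1) (c, d2).

(* finl f d and finr c g are f [] id_d and id_c [] g.  The two readings of
   id_c [] id_d as a generator are the identity of (c, d); the interchange
   relation is absent. *)
Inductive frel : forall u v, fterm u v -> fterm u v -> Prop :=
| frel_refl u v (t : fterm u v) : frel t t
| frel_sym u v (t t' : fterm u v) : frel t t' -> frel t' t
| frel_trans u v (t t' t'' : fterm u v) : frel t t' -> frel t' t'' -> frel t t''
| frel_comp u v w (t t' : fterm v w) (r r' : fterm u v) :
    frel t t' -> frel r r' -> frel (fcomp t r) (fcomp t' r')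
| frel_idl u v (t : fterm u v) : frel (fcomp (fid v) t) t
| frel_idr u v (t : fterm u v) : frel (fcomp t (fid u)) t
| frel_assoc u v w x (t : fterm w x) (r : fterm v w) (q : fterm u v) :
    frel (fcomp t (fcomp r q)) (fcomp (fcomp t r) q)
| frel_inl_id c d : frel (finl (idm C c) d) (fid (c, d))
| frel_inr_id c d : frel (finr c (idm D d)) (fid (c, d))
| frel_inl_comp c1 c2 c3 (f2 : hom C c2 c3) (f1 : hom C c1 c2) d :
    frel (fcomp (finl f2 d) (finl f1 d)) (finl (comp C f2 f1) d)
| frel_inr_comp c d1 d2 d3 (g2 : hom D d2 d3) (g1 : hom D d1 d2) :
    frel (fcomp (finr c g2) (finr c g1)) (finr c (comp D g2 g1)).

Definition fhom u v : Type := {P : fterm u v -> Prop | exists t, P = frel t}.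

Definition fcls u v (t : fterm u v) : fhom u v :=
  exist _ (frel t) (ex_intro _ t erefl).

Definition frep u v (p : fhom u v) : fterm u v := projT1 (cid (proj2_sig p)).

Lemma frepK u v (p : fhom u v) : fcls (frep p) = p.
Proof.
rewrite /frep; case: (cid _) => t; case: p => P HP /= Pt.
by apply: eq_exist; rewrite Pt.
Qed.

Lemma fclsP u v (t t' : fterm u v) : frel t t' -> fcls t = fcls t'.
Proof.
move=> tt'; apply: eq_exist; apply: funext => r; apply: propext; split => h.
  exact: frel_trans (frel_sym tt') h.
exact: frel_trans tt' h.
Qed.

Lemma fcls_inj u v (t t' : fterm u v) : fcls t = fcls t' -> frel t t'.
Proof. by case=> ->; apply: frel_refl. Qed.

Lemma frep_cls u v (t : fterm u v) : frel (frep (fcls t)) t.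
Proof. by apply: fcls_inj; rewrite frepK. Qed.

Definition funny_comp u v w (p : fhom v w) (q : fhom u v) : fhom u w :=
  fcls (fcomp (frep p) (frep q)).

Lemma funny_compE u v w (t : fterm v w) (r : fterm u v) :
  funny_comp (fcls t) (fcls r) = fcls (fcomp t r).
Proof. by apply: fclsP; apply: frel_comp; apply: frep_cls. Qed.

Fact funny_idl u v (p : fhom u v) : funny_comp (fcls (fid v)) p = p.
Proof. by rewrite -(frepK p) funny_compE; apply/fclsP/frel_idl. Qed.

Fact funny_idr u v (p : fhom u v) : funny_comp p (fcls (fid u)) = p.
Proof. by rewrite -(frepK p) funny_compE; apply/fclsP/frel_idr. Qed.

Fact funny_assoc u v w x (p : fhom w x) (q : fhom v w) (r : fhom u v) :
  funny_comp p (funny_comp q r) = funny_comp (funny_comp p q) r.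
Proof.
rewrite -(frepK p) -(frepK q) -(frepK r) !funny_compE.
exact/fclsP/frel_assoc.
Qed.

Definition funny : category (S * T) :=
  Category funny_idl funny_idr funny_assoc.

End Funny.
Arguments fid {S T C D} u.

Section FunnyMap.
Variables (S T S' T' : Type) (C : category S) (D : category T).
Variables (C' : category S') (D' : category T').
Variables (F : functor C C') (G : functor D D').

Definition funny_ob (u : S * T) : S' * T' := (F u.1, G u.2).

Fixpoint fterm_map u v (t : fterm C D u v) :
    fterm C' D' (funny_ob u) (funny_ob v) :=
  match t with
  | fid u => fid (funny_ob u)
  | fcomp _ _ _ t r => fcomp (fterm_map t) (fterm_map r)
  | finl _ _ f d => finl D' (farr F f) (G d)
  | finr c _ _ g => finr C' (F c) (farr G g)
  end.

Lemma fterm_map_rel u v (t t' : fterm C D u v) :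
  frel t t' -> frel (fterm_map t) (fterm_map t').
Proof.
elim=> /= *; do ?[exact: frel_refl | exact: frel_sym | exact: frel_comp
  | exact: frel_idl | exact: frel_idr | exact: frel_assoc].
- by apply: frel_trans; eassumption.
- by rewrite farr_id; apply: frel_inl_id.
- by rewrite farr_id; apply: frel_inr_id.
- by rewrite farr_comp; apply: frel_inl_comp.
- by rewrite farr_comp; apply: frel_inr_comp.
Qed.

Definition funny_arr u v (p : hom (funny C D) u v) :
    hom (funny C' D') (funny_ob u) (funny_ob v) :=
  fcls (fterm_map (frep p)).

Lemma funny_arrE u v (t : fterm C D u v) :
  funny_arr (fcls t) = fcls (fterm_map t).
Proof. exact/fclsP/fterm_map_rel/frep_cls. Qed.

Fact funny_arr_id u : funny_arr (idm (funny C D) u) = idm (funny C' D') (funny_ob u).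
Proof. by rewrite /= funny_arrE. Qed.

Fact funny_arr_comp u v w (p : hom (funny C D) v w) (q : hom (funny C D) u v) :
  funny_arr (comp (funny C D) p q)
  = comp (funny C' D') (funny_arr p) (funny_arr q).
Proof.
rewrite -(frepK p) -(frepK q) /= funny_compE !funny_arrE /=.
by rewrite funny_compE.
Qed.

Definition funny_map : functor (funny C D) (funny C' D') :=
  Functor funny_arr_id funny_arr_comp.

End FunnyMap.

Section Pull.
Variables (S T : Type) (C : category T) (phi : S -> T).

Definition pull : category S :=
  @Category S (fun a b => hom C (phi a) (phi b)) (fun a => idm C (phi a))
    (fun a b c g f => comp C g f)
    (fun a b f => comp_idl f) (fun a b f => comp_idr f)
    (fun a b c d h g f => comp_assoc h g f).

Definition pull_functor : functor pull C :=
  @Functor S T pull C phi (fun a b f => f) (fun=> erefl) (fun _ _ _ _ _ => erefl).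

Variables (psi : T -> S) (psiK : cancel psi phi).

Definition hom_cast a a' b b' (ea : a = a') (eb : b = b') (f : hom C a b) :
    hom C a' b' :=
  match ea in _ = a1, eb in _ = b1 return hom C a1 b1 with
  | erefl, erefl => f
  end.

Fact unpull_id a : hom_cast (esym (psiK a)) (esym (psiK a)) (idm C a)
  = idm C (phi (psi a)).
Proof. by case: _ / (esym _). Qed.

Fact unpull_comp a b c (g : hom C b c) (f : hom C a b) :
  hom_cast (esym (psiK a)) (esym (psiK c)) (comp C g f)
  = comp C (hom_cast (esym (psiK b)) (esym (psiK c)) g)
           (hom_cast (esym (psiK a)) (esym (psiK b)) f).
Proof.
by case: _ / (esym (psiK a)); case: _ / (esym (psiK b));
  case: _ / (esym (psiK c)).
Qed.

Definition unpull_functor : functor C pull :=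
  @Functor T S C pull psi
    (fun a b f => hom_cast (esym (psiK a)) (esym (psiK b)) f)
    unpull_id unpull_comp.

End Pull.

Lemma is_identity_functor S T (C : category S) (D : category T)
    (F : functor C D) a b (f : hom C a b) :
  is_identity f -> is_identity (farr F f).
Proof. by case=> c; rewrite farr_id. Qed.

Lemma is_identity_comp T (C : category T) a b c (g : hom C b c) (f : hom C a b) :
  is_identity g -> is_identity f -> is_identity (comp C g f).
Proof. by move=> ig; case: ig f => d f; rewrite comp_idl. Qed.

Lemma is_identity_ob T (C : category T) a b (f : hom C a b) :
  is_identity f -> a = b.
Proof. by case. Qed.

Lemma is_identityE T (C : category T) a b (f : hom C a b) (e : a = b) :
  is_identity f -> f = hom_cast erefl e (idm C a).
Proof. by move=> idf; case: idf e => c e; rewrite (Prop_irrelevance e erefl). Qed.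

Lemma is_identity_uniq T (C : category T) a b (f g : hom C a b) :
  is_identity f -> is_identity g -> f = g.
Proof.
by move=> idf idg; rewrite (is_identityE (is_identity_ob idf) idf)
  -(is_identityE _ idg).
Qed.

Lemma final_is_identity T (C : category T) a b (f : hom C a b) :
  final C -> is_identity f.
Proof.
move=> [[o [_ oE]] H]; move: f; rewrite -(oE a I) -(oE b I) => f.
by have [h [_ hE]] := H o o; rewrite -(hE f I) (hE (idm C o) I).
Qed.

Lemma is_identity_final T (C : category T) (o : T) :
  (forall a, a = o) -> (forall a b (f : hom C a b), is_identity f) -> final C.
Proof.
move=> oE idC; split; first by exists o; split=> // a _; rewrite (oE a).
move=> a b; rewrite (oE a) (oE b); exists (idm C o); split=> // f _.
exact: is_identity_uniq (IsIdentity _ _) (idC _ _ _).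
Qed.

Section FunnyInterval.
Variables (S T : Type) (C : category S) (D : category T).

Fixpoint fterm_fst u v (t : fterm C D u v) : hom C u.1 v.1 :=
  match t with
  | fid u => idm C u.1
  | fcomp _ _ _ t r => comp C (fterm_fst t) (fterm_fst r)
  | finl _ _ f d => f
  | finr c _ _ g => idm C c
  end.

Fixpoint fterm_snd u v (t : fterm C D u v) : hom D u.2 v.2 :=
  match t with
  | fid u => idm D u.2
  | fcomp _ _ _ t r => comp D (fterm_snd t) (fterm_snd r)
  | finl _ _ f d => idm D d
  | finr c _ _ g => g
  end.

Lemma fterm_fst_rel u v (t t' : fterm C D u v) :
  frel t t' -> fterm_fst t = fterm_fst t'.
Proof.
by elim=> //= *; rewrite ?comp_idl ?comp_idr ?comp_assoc //; congruence.
Qed.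

Lemma fterm_snd_rel u v (t t' : fterm C D u v) :
  frel t t' -> fterm_snd t = fterm_snd t'.
Proof.
by elim=> //= *; rewrite ?comp_idl ?comp_idr ?comp_assoc //; congruence.
Qed.

Lemma fcls_id_fst u v (t : fterm C D u v) :
  @is_identity _ (funny C D) u v (fcls t) -> is_identity (fterm_fst t).
Proof.
suff H p : @is_identity _ (funny C D) u v p -> is_identity (fterm_fst (frep p)).
  by move=> /H; rewrite (fterm_fst_rel (frep_cls t)).
by case=> w /=; rewrite (fterm_fst_rel (frep_cls _)).
Qed.

Lemma fcls_id_snd u v (t : fterm C D u v) :
  @is_identity _ (funny C D) u v (fcls t) -> is_identity (fterm_snd t).
Proof.
suff H p : @is_identity _ (funny C D) u v p -> is_identity (fterm_snd (frep p)).
  by move=> /H; rewrite (fterm_snd_rel (frep_cls t)).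
by case=> w /=; rewrite (fterm_snd_rel (frep_cls _)).
Qed.

Lemma finl_id c1 c2 (f : hom C c1 c2) d :
  is_identity f -> @is_identity _ (funny C D) _ _ (fcls (finl D f d)).
Proof. by case=> c; rewrite (fclsP (frel_inl_id _ _ _ _)). Qed.

Lemma finr_id c d1 d2 (g : hom D d1 d2) :
  is_identity g -> @is_identity _ (funny C D) _ _ (fcls (finr C c g)).
Proof. by case=> d; rewrite (fclsP (frel_inr_id _ _ _ _)). Qed.

Lemma funny_min c d :
  minimum (funny C D) (c, d) <-> minimum C c /\ minimum D d.
Proof.
split=> [m|[mc md]].
  split=> a f; first exact: fcls_id_fst (m _ (fcls (finl D f d))).
  exact: fcls_id_snd (m _ (fcls (finr C c f))).
suff H u v (t : fterm C D u v) : minimum C v.1 -> minimum D v.2 ->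
    @is_identity _ (funny C D) u v (fcls t).
  by move=> u p; rewrite -[p]frepK; apply: H.
elim: t => {u v}.
- by move=> u _ _; exact: IsIdentity.
- move=> u v w t IHt r IHr m1 m2; rewrite -funny_compE.
  have it := IHt m1 m2; have vw := is_identity_ob it.
  by apply: is_identity_comp => //; apply: IHr; rewrite vw.
- by move=> c1 c2 f d' m _; apply/finl_id/m.
- by move=> c' d1 d2 g _ m; apply/finr_id/m.
Qed.

Lemma funny_max c d :
  maximum (funny C D) (c, d) <-> maximum C c /\ maximum D d.
Proof.
split=> [m|[mc md]].
  split=> a f; first exact: fcls_id_fst (m _ (fcls (finl D f d))).
  exact: fcls_id_snd (m _ (fcls (finr C c f))).
suff H u v (t : fterm C D u v) : maximum C u.1 -> maximum D u.2 ->
    @is_identity _ (funny C D) u v (fcls t).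
  by move=> u p; rewrite -[p]frepK; apply: H.
elim: t => {u v}.
- by move=> u _ _; exact: IsIdentity.
- move=> u v w t IHt r IHr m1 m2; rewrite -funny_compE.
  have ir := IHr m1 m2; have uv := is_identity_ob ir.
  by apply: is_identity_comp => //; apply: IHt; rewrite -uv.
- by move=> c1 c2 f d' m _; apply/finl_id/m.
- by move=> c' d1 d2 g _ m; apply/finr_id/m.
Qed.

Lemma zigzag_trans U (E : category U) a b c :
  zigzag E a b -> zigzag E b c -> zigzag E a c.
Proof.
by move=> ab; elim=> // x y _; [apply: zz_fwd | apply: zz_bwd].
Qed.

Lemma funny_connected : connected C -> connected D -> connected (funny C D).
Proof.
move=> [[c0] cC] [[d0] cD]; split=> [|[c d] [c' d']]; first exact: inhabits (c0, d0).
apply: (@zigzag_trans _ _ _ (c', d)).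
  elim: (cC c c') => [|x y _ IH f|x y _ IH f]; first exact: zz_refl.
  - exact: zz_fwd IH (fcls (finl D f d)).
  - exact: zz_bwd IH (fcls (finl D f d)).
elim: (cD d d') => [|x y _ IH f|x y _ IH f]; first exact: zz_refl.
- exact: zz_fwd IH (fcls (finr C c' f)).
- exact: zz_bwd IH (fcls (finr C c' f)).
Qed.

Lemma funny_final : final C -> final D -> final (funny C D).
Proof.
move=> fC fD; have [[c [_ cE]] _] := fC; have [[d [_ dE]] _] := fD.
apply: (@is_identity_final _ _ (c, d)) => [[a b]|u [a b]].
  by rewrite (cE a I) (dE b I).
by apply: (proj2 (funny_min a b)); split=> x f; apply: final_is_identity.
Qed.

Lemma funny_interval m M m' M' :
  gen_interval C m M -> gen_interval D m' M' ->
  gen_interval (funny C D) (m, m') (M, M').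
Proof.
move=> [cC mC MC fC] [cD mD MD fD]; split=> [|[a b]|[a b]|[/fC fC' /fD fD']].
- exact: funny_connected.
- by rewrite funny_min mC mD; split=> [[-> ->]|[-> ->]].
- by rewrite funny_max MC MD; split=> [[-> ->]|[-> ->]].
- exact: funny_final.
Qed.

End FunnyInterval.

Section PullInterval.
Variables (S T : Type) (C : category T) (phi : S -> T) (psi : T -> S).
Hypotheses (psiK : cancel psi phi) (phiK : cancel phi psi).

Lemma pull_identity a b (f : hom (pull C phi) a b) :
  is_identity f <-> @is_identity _ C (phi a) (phi b) f.
Proof.
split=> [|idf]; first exact: (is_identity_functor (pull_functor C phi)).
have ab : a = b by apply: (can_inj phiK); exact: is_identity_ob idf.
case: b / ab f idf => f idf.
have -> : f = idm (pull C phi) a by apply: is_identity_uniq idf (IsIdentity _ _).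
exact: IsIdentity.
Qed.

Lemma pull_min a : minimum (pull C phi) a <-> minimum C (phi a).
Proof.
split=> m b f; last by apply/pull_identity/m.
by move: f; rewrite -[b]psiK => f; apply/pull_identity/m.
Qed.

Lemma pull_max a : maximum (pull C phi) a <-> maximum C (phi a).
Proof.
split=> m b f; last by apply/pull_identity/m.
by move: f; rewrite -[b]psiK => f; apply/pull_identity/m.
Qed.

Lemma pull_interval m M :
  gen_interval C (phi m) (phi M) -> gen_interval (pull C phi) m M.
Proof.
move=> [[[o] cC] mC MC fC]; split=> [|a|a|mM].
- split=> [|a b]; first exact: inhabits (psi o).
  rewrite -[a]phiK -[b]phiK; elim: (cC (phi a) (phi b)) => [|x y _ IH f|x y _ IH f].
  + exact: zz_refl.
  + by apply: zz_fwd IH _; rewrite /= !psiK.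
  + by apply: zz_bwd IH _; rewrite /= !psiK.
- by rewrite pull_min mC; split=> [/(can_inj phiK)|->].
- by rewrite pull_max MC; split=> [/(can_inj phiK)|->].
- have fC' : final C by apply: fC; rewrite mM.
  have [[c [_ cE]] _] := fC'.
  apply: (@is_identity_final _ _ (psi c)) => [a|a b f].
    by apply: (can_inj phiK); rewrite psiK (cE (phi a) I).
  exact/pull_identity/final_is_identity.
Qed.

End PullInterval.

Definition fibre A B (i : A -> B) (b : B) : Type := {a : A | i a = b}.

(* The levels are indexed by 0, .., n.  The structure maps between levels j and
   k carry a proof of k = j + 1 (unique, since nat is a set), so that they can
   be composed without casts; dn, src, tgt are i_j, s_j, t_j.

   Fibres over boundary points are degenerate (boundary_degenerate).  The
   converse, "the fibre over x is degenerate only if x is a boundary point", is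
   deliberately not required: it is not stable under the levelwise product (see
   funny_corner_degenerate), so with it the funny product of two disks need not
   be a disk for n >= 2.  At level 0, where there is no boundary, it would also
   exclude the disk all of whose levels are singletons. *)
Record gdisk (n : nat) := GDisk {
  lev : 'I_n.+1 -> Type;
  dn : forall j k : 'I_n.+1, k = j.+1 :> nat -> lev k -> lev j;
  src : forall j k : 'I_n.+1, k = j.+1 :> nat -> lev j -> lev k;
  tgt : forall j k : 'I_n.+1, k = j.+1 :> nat -> lev j -> lev k;
  src_src : forall (j k l : 'I_n.+1) (e : k = j.+1 :> nat) (e' : l = k.+1 :> nat) x,
    src e' (src e x) = tgt e' (src e x);
  src_tgt : forall (j k l : 'I_n.+1) (e : k = j.+1 :> nat) (e' : l = k.+1 :> nat) x,
    src e' (tgt e x) = tgt e' (tgt e x);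
  dn_src : forall (j k : 'I_n.+1) (e : k = j.+1 :> nat) x, dn e (src e x) = x;
  dn_tgt : forall (j k : 'I_n.+1) (e : k = j.+1 :> nat) x, dn e (tgt e x) = x;
  lev0 : exists! x : lev ord0, True;
  fib : forall (j k : 'I_n.+1) (e : k = j.+1 :> nat) x, category (fibre (dn e) x);
  fib_interval : forall (j k : 'I_n.+1) (e : k = j.+1 :> nat) x,
    gen_interval (fib e x) (exist _ (src e x) (dn_src e x))
                           (exist _ (tgt e x) (dn_tgt e x)) }.
Arguments lev {n} X k : rename.
Arguments dn {n} X {j k} e x : rename.
Arguments src {n} X {j k} e x : rename.
Arguments tgt {n} X {j k} e x : rename.
Arguments fib {n} X {j k} e x : rename.

Definition boundary n (X : gdisk n) (k : 'I_n.+1) (x : lev X k) : Prop :=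
  exists (j : 'I_n.+1) (e : k = j.+1 :> nat) y, x = src X e y \/ x = tgt X e y.

Lemma boundary_degenerate n (X : gdisk n) (k l : 'I_n.+1) (e : l = k.+1 :> nat)
  (x : lev X k) : boundary x -> final (fib X e x).
Proof.
move=> [j [e' [y xE]]]; apply: (gi_final (fib_interval e x)); apply: eq_exist.
by case: xE => ->; [apply: src_src | apply: src_tgt].
Qed.

(* The fibre part is a functor whose object map is the restriction of lmap. *)
Record gdisk_hom n (X Y : gdisk n) := GDiskHom {
  lmap : forall k, lev X k -> lev Y k;
  lmap_dn : forall (j k : 'I_n.+1) (e : k = j.+1 :> nat) x,
    lmap (dn X e x) = dn Y e (lmap x);
  lmap_src : forall (j k : 'I_n.+1) (e : k = j.+1 :> nat) x,
    lmap (src X e x) = src Y e (lmap x);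
  lmap_tgt : forall (j k : 'I_n.+1) (e : k = j.+1 :> nat) x,
    lmap (tgt X e x) = tgt Y e (lmap x);
  fmap : forall (j k : 'I_n.+1) (e : k = j.+1 :> nat) x,
    functor (fib X e x) (fib Y e (lmap x));
  fmapE : forall (j k : 'I_n.+1) (e : k = j.+1 :> nat) x (a : fibre (dn X e) x),
    sval (fmap e x a) = lmap (sval a) }.
Arguments lmap {n X Y} f {k} x : rename.
Arguments fmap {n X Y} f {j k} e x : rename.

Lemma gdisk_hom_eq n (X Y : gdisk n) (l : forall k, lev X k -> lev Y k)
    (F F' : forall (j k : 'I_n.+1) (e : k = j.+1 :> nat) x, functor (fib X e x) (fib Y e (l j x)))
    p1 p2 p3 p4 p1' p2' p3' p4' :
  (forall (j k : 'I_n.+1) (e : k = j.+1 :> nat) x, F j k e x = F' j k e x) ->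
  @GDiskHom n X Y l p1 p2 p3 F p4 = @GDiskHom n X Y l p1' p2' p3' F' p4'.
Proof.
move=> FF'; have EF : F = F'.
  do 4![apply: functional_extensionality_dep => ?]; exact: FF'.
case: F' / EF p4' {FF'} => p4'.
by rewrite (Prop_irrelevance p1 p1') (Prop_irrelevance p2 p2')
  (Prop_irrelevance p3 p3') (Prop_irrelevance p4 p4').
Qed.

Definition gdisk_id n (X : gdisk n) : gdisk_hom X X :=
  @GDiskHom n X X (fun _ x => x) (fun _ _ _ _ => erefl) (fun _ _ _ _ => erefl)
    (fun _ _ _ _ => erefl) (fun _ _ e x => functor_id (fib X e x))
    (fun _ _ _ _ _ => erefl).

Section GDiskComp.
Variables (n : nat) (X Y Z : gdisk n) (g : gdisk_hom Y Z) (f : gdisk_hom X Y).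

Fact gdisk_comp_dn (j k : 'I_n.+1) (e : k = j.+1 :> nat) x :
  lmap g (lmap f (dn X e x)) = dn Z e (lmap g (lmap f x)).
Proof. by rewrite !lmap_dn. Qed.

Fact gdisk_comp_src (j k : 'I_n.+1) (e : k = j.+1 :> nat) x :
  lmap g (lmap f (src X e x)) = src Z e (lmap g (lmap f x)).
Proof. by rewrite !lmap_src. Qed.

Fact gdisk_comp_tgt (j k : 'I_n.+1) (e : k = j.+1 :> nat) x :
  lmap g (lmap f (tgt X e x)) = tgt Z e (lmap g (lmap f x)).
Proof. by rewrite !lmap_tgt. Qed.

Fact gdisk_comp_fmapE (j k : 'I_n.+1) (e : k = j.+1 :> nat) x
    (a : fibre (dn X e) x) :
  sval (functor_comp (fmap g e (lmap f x)) (fmap f e x) a)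
  = lmap g (lmap f (sval a)).
Proof. by rewrite /= !fmapE. Qed.

Definition gdisk_comp : gdisk_hom X Z :=
  @GDiskHom n X Z (fun _ x => lmap g (lmap f x)) gdisk_comp_dn gdisk_comp_src
    gdisk_comp_tgt (fun _ _ e x => functor_comp (fmap g e (lmap f x)) (fmap f e x))
    gdisk_comp_fmapE.

End GDiskComp.

Fact gdisk_comp_idl n (X Y : gdisk n) (f : gdisk_hom X Y) :
  gdisk_comp (gdisk_id Y) f = f.
Proof.
by case: f => *; apply: gdisk_hom_eq => j k e x /=; case: (X in _ = X) => *;
  apply: functor_eq.
Qed.

Fact gdisk_comp_idr n (X Y : gdisk n) (f : gdisk_hom X Y) :
  gdisk_comp f (gdisk_id X) = f.
Proof.
by case: f => *; apply: gdisk_hom_eq => j k e x /=; case: (X in _ = X) => *;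
  apply: functor_eq.
Qed.

Fact gdisk_comp_assoc n (X Y Z W : gdisk n) (h : gdisk_hom Z W)
    (g : gdisk_hom Y Z) (f : gdisk_hom X Y) :
  gdisk_comp h (gdisk_comp g f) = gdisk_comp (gdisk_comp h g) f.
Proof. by apply: gdisk_hom_eq => j k e x /=; apply: functor_eq. Qed.

Definition gdisk_category n : category (gdisk n) :=
  @Category (gdisk n) (@gdisk_hom n) (@gdisk_id n) (@gdisk_comp n)
    (@gdisk_comp_idl n) (@gdisk_comp_idr n) (@gdisk_comp_assoc n).

Definition final_category T : category T :=
  @Category T (fun _ _ => unit) (fun=> tt) (fun _ _ _ _ _ => tt)
    (fun _ _ f => let: tt := f in erefl) (fun _ _ f => let: tt := f in erefl)
    (fun _ _ _ _ _ _ _ => erefl).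

Lemma final_category_interval T (o : T) :
  (forall a, a = o) -> gen_interval (final_category T) o o.
Proof.
move=> oE.
have idT a b (f : hom (final_category T) a b) : is_identity f.
  by move: f; rewrite (oE a) (oE b) => -[]; exact: (IsIdentity (final_category T) o).
split=> [|a|a|_]; last exact: is_identity_final oE idT.
- split=> [|a b]; first exact: inhabits o.
  by rewrite (oE a) (oE b); exact: zz_refl.
- by split=> _ //; move=> b f; apply: idT.
- by split=> _ //; move=> b f; apply: idT.
Qed.

Section Degenerate.
Variable n : nat.
Let dn1 (j k : 'I_n.+1) (e : k = j.+1 :> nat) (x : unit) : unit := x.

Fact degenerate_interval (j k : 'I_n.+1) (e : k = j.+1 :> nat) (x : unit) :
  gen_interval (final_category (fibre (dn1 e) x))
    (exist _ (dn1 e x) erefl) (exist _ (dn1 e x) erefl).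
Proof.
by apply: final_category_interval => -[[] a]; apply: eq_exist; case: x a.
Qed.

Fact degenerate_lev0 : exists! x : unit, True.
Proof. by exists tt; split=> // -[]. Qed.

Definition degenerate : gdisk n :=
  @GDisk n (fun=> unit) dn1 dn1 dn1
    (fun _ _ _ _ _ _ => erefl) (fun _ _ _ _ _ _ => erefl)
    (fun _ _ _ _ => erefl) (fun _ _ _ _ => erefl) degenerate_lev0
    (fun j k e x => final_category (fibre (dn1 e) x)) degenerate_interval.

End Degenerate.

Section FibrePair.
Variables (A B A' B' : Type) (i : A -> B) (i' : A' -> B').

Definition pmap (a : A * A') : B * B' := (i a.1, i' a.2).

Definition fib_split u (a : fibre pmap u) : fibre i u.1 * fibre i' u.2 :=
  (exist _ (sval a).1 (congr1 fst (proj2_sig a)),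
   exist _ (sval a).2 (congr1 snd (proj2_sig a))).

Fact fib_pair_subproof u (p : fibre i u.1 * fibre i' u.2) :
  pmap (sval p.1, sval p.2) = u.
Proof. by case: u p => u u' [[a /= <-] [a' /= <-]]. Qed.

Definition fib_pair u (p : fibre i u.1 * fibre i' u.2) : fibre pmap u :=
  exist _ (sval p.1, sval p.2) (fib_pair_subproof p).

Lemma fib_pairK u : cancel (@fib_pair u) (@fib_split u).
Proof. by move=> [[a p] [a' p']]; congr (_, _); apply: eq_exist. Qed.

Lemma fib_splitK u : cancel (@fib_split u) (@fib_pair u).
Proof. by move=> [[a a'] p]; apply: eq_exist. Qed.

End FibrePair.

Section FunnyDisk.
Variables (n : nat) (X Y : gdisk n).

Let flev k : Type := lev X k * lev Y k.
Let fdn (j k : 'I_n.+1) (e : k = j.+1 :> nat) : flev k -> flev j :=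
  pmap (dn X e) (dn Y e).
Let fsrc (j k : 'I_n.+1) (e : k = j.+1 :> nat) (u : flev j) : flev k :=
  (src X e u.1, src Y e u.2).
Let ftgt (j k : 'I_n.+1) (e : k = j.+1 :> nat) (u : flev j) : flev k :=
  (tgt X e u.1, tgt Y e u.2).

Fact funny_src_src (j k l : 'I_n.+1) (e : k = j.+1 :> nat)
  (e' : l = k.+1 :> nat) u : fsrc e' (fsrc e u) = ftgt e' (fsrc e u).
Proof. by rewrite /fsrc /ftgt /= !src_src. Qed.

Fact funny_src_tgt (j k l : 'I_n.+1) (e : k = j.+1 :> nat)
  (e' : l = k.+1 :> nat) u : fsrc e' (ftgt e u) = ftgt e' (ftgt e u).
Proof. by rewrite /fsrc /ftgt /= !src_tgt. Qed.

Fact funny_dn_src (j k : 'I_n.+1) (e : k = j.+1 :> nat) u :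
  fdn e (fsrc e u) = u.
Proof. by case: u => x y; rewrite /fdn /pmap /= !dn_src. Qed.

Fact funny_dn_tgt (j k : 'I_n.+1) (e : k = j.+1 :> nat) u :
  fdn e (ftgt e u) = u.
Proof. by case: u => x y; rewrite /fdn /pmap /= !dn_tgt. Qed.

Fact funny_lev0 : exists! u : flev ord0, True.
Proof.
have [x [_ xE]] := lev0 X; have [y [_ yE]] := lev0 Y.
by exists (x, y); split=> // -[a b] _; rewrite (xE a) // (yE b).
Qed.

(* The fibre over u, with the structure of the funny product of the fibres over
   u.1 and u.2 transported along the bijection fib_split. *)
Definition funny_fib (j k : 'I_n.+1) (e : k = j.+1 :> nat) (u : flev j) :
    category (fibre (fdn e) u) :=
  pull (funny (fib X e u.1) (fib Y e u.2)) (@fib_split _ _ _ _ _ _ u).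

Fact funny_fib_interval (j k : 'I_n.+1) (e : k = j.+1 :> nat) u :
  gen_interval (funny_fib e u) (exist _ (fsrc e u) (funny_dn_src e u))
                               (exist _ (ftgt e u) (funny_dn_tgt e u)).
Proof.
apply: (pull_interval (@fib_pairK _ _ _ _ _ _ u) (@fib_splitK _ _ _ _ _ _ u)).
have := funny_interval (fib_interval (g := X) e u.1) (fib_interval (g := Y) e u.2).
by congr gen_interval; congr (_, _); apply: eq_exist.
Qed.

Definition funny_disk : gdisk n :=
  @GDisk n flev fdn fsrc ftgt funny_src_src funny_src_tgt funny_dn_src
    funny_dn_tgt funny_lev0 funny_fib funny_fib_interval.

(* Hence requiring degenerate fibres to lie over the boundary would not be
   stable under funny products: for n >= 2, take the corner (src x, tgt y) in
   disks whose fibre at level 0 is not degenerate. *)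
Lemma funny_corner_degenerate (j k l : 'I_n.+1) (e : k = j.+1 :> nat)
    (e' : l = k.+1 :> nat) x y (u : lev funny_disk k := (src X e x, tgt Y e y)) :
  final (fib funny_disk e' u)
  /\ (boundary u -> src X e x = tgt X e x \/ src Y e y = tgt Y e y).
Proof.
split.
  apply: (gi_final (fib_interval (g := funny_disk) e' u)); apply: eq_exist.
  by rewrite /= /fsrc /ftgt /= src_src src_tgt.
have injk (j' : 'I_n.+1) : k = j'.+1 :> nat -> j' = j.
  by rewrite e => -[jj']; apply: val_inj.
move=> [j' [e1 [[x' y'] uE]]]; have jE := injk _ e1; move: e1 x' y' uE; rewrite jE => e1.
rewrite (Prop_irrelevance e1 e) {e1} => x' y' [] [ex ey]; [right|left].
- by have := congr1 (dn Y e) ey; rewrite dn_tgt dn_src => yE; rewrite ey yE.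
- by have := congr1 (dn X e) ex; rewrite dn_tgt dn_src => xE; rewrite ex xE.
Qed.

End FunnyDisk.

Section FunnyHom.
Variables (n : nat) (X X' Y Y' : gdisk n).
Variables (f : gdisk_hom X X') (g : gdisk_hom Y Y').
Let P := funny_disk X Y.
Let P' := funny_disk X' Y'.
Let fg (k : 'I_n.+1) (u : lev P k) : lev P' k := (lmap f u.1, lmap g u.2).

Fact funny_hom_dn (j k : 'I_n.+1) (e : k = j.+1 :> nat) u :
  fg (dn P e u) = dn P' e (fg u).
Proof. by rewrite /fg /= !lmap_dn. Qed.

Fact funny_hom_src (j k : 'I_n.+1) (e : k = j.+1 :> nat) u :
  fg (src P e u) = src P' e (fg u).
Proof. by rewrite /fg /= !lmap_src. Qed.

Fact funny_hom_tgt (j k : 'I_n.+1) (e : k = j.+1 :> nat) u :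
  fg (tgt P e u) = tgt P' e (fg u).
Proof. by rewrite /fg /= !lmap_tgt. Qed.

Definition funny_fmap (j k : 'I_n.+1) (e : k = j.+1 :> nat) (u : lev P j) :
    functor (fib P e u) (fib P' e (fg u)) :=
  functor_comp (unpull_functor _ (@fib_pairK _ _ _ _ _ _ (fg u)))
    (functor_comp (funny_map (fmap f e u.1) (fmap g e u.2)) (pull_functor _ _)).

Fact funny_fmapE (j k : 'I_n.+1) (e : k = j.+1 :> nat) u (a : fibre (dn P e) u) :
  sval (funny_fmap e u a) = fg (sval a).
Proof. by rewrite /= !fmapE. Qed.

Definition funny_hom : gdisk_hom P P' :=
  GDiskHom funny_hom_dn funny_hom_src funny_hom_tgt funny_fmapE.

End FunnyHom.

Record iso T (C : category T) (a b : T) := Iso {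
  fwd :> hom C a b;
  bwd : hom C b a;
  fwdK : comp C bwd fwd = idm C a;
  bwdK : comp C fwd bwd = idm C b }.

(* Symmetric monoidal structures on C with a given tensor product (of objects
   and of arrows) and a given unit. *)
Record symmetric_monoidal T (C : category T) (ten : T -> T -> T)
    (tena : forall {a a' b b'}, hom C a a' -> hom C b b' ->
      hom C (ten a b) (ten a' b'))
    (one : T) := SymmetricMonoidal {
  ten_id : forall a b, tena (idm C a) (idm C b) = idm C (ten a b);
  ten_comp : forall a a' a'' b b' b'' (f' : hom C a' a'') (f : hom C a a')
    (g' : hom C b' b'') (g : hom C b b'),
    tena (comp C f' f) (comp C g' g) = comp C (tena f' g') (tena f g);
  assoc : forall a b c, iso C (ten (ten a b) c) (ten a (ten b c));
  lunit : forall a, iso C (ten one a) a;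
  runit : forall a, iso C (ten a one) a;
  braid : forall a b, iso C (ten a b) (ten b a);
  assoc_nat : forall a a' b b' c c' (f : hom C a a') (g : hom C b b')
    (h : hom C c c'),
    comp C (assoc a' b' c') (tena (tena f g) h)
    = comp C (tena f (tena g h)) (assoc a b c);
  lunit_nat : forall a a' (f : hom C a a'),
    comp C (lunit a') (tena (idm C one) f) = comp C f (lunit a);
  runit_nat : forall a a' (f : hom C a a'),
    comp C (runit a') (tena f (idm C one)) = comp C f (runit a);
  braid_nat : forall a a' b b' (f : hom C a a') (g : hom C b b'),
    comp C (braid a' b') (tena f g) = comp C (tena g f) (braid a b);
  pentagon : forall a b c d,
    comp C (assoc a b (ten c d)) (assoc (ten a b) c d)
    = comp C (tena (idm C a) (assoc b c d))
        (comp C (assoc a (ten b c) d) (tena (assoc a b c) (idm C d)));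
  triangle : forall a b,
    comp C (tena (idm C a) (lunit b)) (assoc a one b)
    = tena (runit a) (idm C b);
  hexagon : forall a b c,
    comp C (assoc b c a) (comp C (braid a (ten b c)) (assoc a b c))
    = comp C (tena (idm C b) (braid a c))
        (comp C (assoc b a c) (tena (braid a b) (idm C c)));
  symmetry : forall a b, comp C (braid b a) (braid a b) = idm C (ten a b) }.

(* Main.v *)
From mathcomp Require Import all_boot.
From mathcomp Require Import boolp.
Require Import Defs.

Set Implicit Arguments.
Unset Strict Implicit.
Unset Printing Implicit Defensive.

(** A functor out of a funny product is determined by its values on the
    generators f [] id and id [] g, and conversely is given by one family of
    functors in each variable, with no compatibility between the two families
    beyond agreement on objects.  Swapping the factors and reassociating three
    factors merely permute generators, so they extend to functors
    ([funny_swap], [funny_assoc]); together with the projection that discards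
    the arrows of the first factor ([funny_proj2]) they give, fibre by fibre,
    the braiding, the associator and the left unitor of disks.  The latter is
    invertible because the degenerate disk has only identity arrows in its
    fibres.  The right unitor and the inverse associator are obtained from
    these by composing with braidings.

    All remaining laws are equalities between homs out of iterated funny
    products.  Such homs are equal as soon as they agree on the points of the
    levels and on the generating fibre arrows ([funny_hom_ext] and its
    iterations), and there each structure map has an explicit value
    ([dmapE]), so every law becomes a computation.

    The only real difficulty is that the fibres over (x, y) are transported
    along a bijection with the product of fibres, which makes the two sides of
    a law have merely propositionally equal endpoints.  This is handled by
    regarding the fibre arrows of a disk X at a given level as one set
    [darr X], with identities [did] and a composition relation [dcomp]; a hom
    acts on it by an ordinary function [dmap], and so do the two ways [dinl]
    and [dinr] of building generators.  All these functions preserve identities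
    and composites ([functorial]), and two such functions out of
    [darr (funny_disk X Y)] that agree on generators are equal
    ([funny_darr_ext]). *)

(** * Arrows with free endpoints *)

(** Coherence laws compare arrows whose endpoints agree only up to a
    propositional equality (a pair is not convertible to the pair of its
    projections, and fibre elements carry proofs).  Packing the endpoints with
    the arrow lets such comparisons be stated by plain equality. *)
Record arr T (C : category T) := Arr {
  asrc : T; atgt : T; ahom : hom C asrc atgt }.

Definition amap S T (C : category S) (D : category T) (F : functor C D)
    (p : arr C) : arr D :=
  Arr (farr F (ahom p)).

Lemma amap_functor_id T (C : category T) (p : arr C) : amap (functor_id C) p = p.
Proof. by case: p. Qed.

Lemma amap_functor_comp S T U (C : category S) (D : category T) (E : category U)
    (G : functor D E) (F : functor C D) (p : arr C) :
  amap (functor_comp G F) p = amap G (amap F p).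
Proof. by []. Qed.

(** Holds because equality proofs between objects are irrelevant: the
    equalities of endpoints extracted from the hypothesis are reflexivities. *)
Lemma Arr_inj T (C : category T) a b (f g : hom C a b) : Arr f = Arr g -> f = g.
Proof.
have cast (p q : arr C) : p = q -> exists (ea : asrc p = asrc q)
    (eb : atgt p = atgt q), hom_cast ea eb (ahom p) = ahom q.
  by move=> ->; exists erefl, erefl.
move=> /cast [/= ea [eb <-]].
by rewrite (Prop_irrelevance ea erefl) (Prop_irrelevance eb erefl).
Qed.

Lemma Arr_cast T (C : category T) a a' b b' (ea : a = a') (eb : b = b')
  (f : hom C a b) : Arr (hom_cast ea eb f) = Arr f.
Proof. by case: _ / ea; case: _ / eb. Qed.

Section PullArrows.
Variables (S T : Type) (C : category T) (phi : S -> T) (psi : T -> S).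
Hypotheses (psiK : cancel psi phi) (phiK : cancel phi psi).

Lemma amap_unpullK p : amap (pull_functor C phi) (amap (unpull_functor C psiK) p) = p.
Proof. by case: p => a b f; apply: Arr_cast. Qed.

Lemma amap_pullK p : amap (unpull_functor C psiK) (amap (pull_functor C phi) p) = p.
Proof.
case: p => a b f.
suff H a' b' (ea : a = a') (eb : b = b') (ha : phi a = phi a') (hb : phi b = phi b') :
    @Arr _ (pull C phi) a' b' (hom_cast ha hb f) = Arr f.
  exact: H (esym (phiK a)) (esym (phiK b)) _ _.
case: a' / ea ha => ha; case: b' / eb hb => hb.
by rewrite (Prop_irrelevance ha erefl) (Prop_irrelevance hb erefl).
Qed.

End PullArrows.

(** * Functors out of a funny product *)

(** The universal property of the funny product: functorial actions of the
    arrows of C and of D, sharing an object map, extend to a functor; the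
    absence of the interchange relation is what spares any further
    condition. *)
Section FunnyElim.
Variables (S T U : Type) (C : category S) (D : category T) (E : category U).
Variable ob : S * T -> U.
Variable l : forall c1 c2, hom C c1 c2 -> forall d,
  hom E (ob (c1, d)) (ob (c2, d)).
Variable r : forall c d1 d2, hom D d1 d2 -> hom E (ob (c, d1)) (ob (c, d2)).
Hypothesis l_id : forall c d, l (idm C c) d = idm E (ob (c, d)).
Hypothesis r_id : forall c d, r c (idm D d) = idm E (ob (c, d)).
Hypothesis l_comp : forall c1 c2 c3 (f2 : hom C c2 c3) (f1 : hom C c1 c2) d,
  l (comp C f2 f1) d = comp E (l f2 d) (l f1 d).
Hypothesis r_comp : forall c d1 d2 d3 (g2 : hom D d2 d3) (g1 : hom D d1 d2),
  r c (comp D g2 g1) = comp E (r c g2) (r c g1).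

Fixpoint fterm_elim u v (t : fterm C D u v) : hom E (ob u) (ob v) :=
  match t with
  | fid u => idm E (ob u)
  | fcomp _ _ _ t q => comp E (fterm_elim t) (fterm_elim q)
  | finl _ _ f d => l f d
  | finr c _ _ g => r c g
  end.

Lemma fterm_elim_rel u v (t t' : fterm C D u v) :
  frel t t' -> fterm_elim t = fterm_elim t'.
Proof.
by elim=> //= *; rewrite ?comp_idl ?comp_idr ?comp_assoc //; congruence.
Qed.

Definition funny_elim_arr u v (p : hom (funny C D) u v) : hom E (ob u) (ob v) :=
  fterm_elim (frep p).

Lemma funny_elim_cls u v (t : fterm C D u v) :
  funny_elim_arr (fcls t) = fterm_elim t.
Proof. exact/fterm_elim_rel/frep_cls. Qed.

Fact funny_elim_id u : funny_elim_arr (idm (funny C D) u) = idm E (ob u).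
Proof. by rewrite /= funny_elim_cls. Qed.

Fact funny_elim_comp u v w (p : hom (funny C D) v w) (q : hom (funny C D) u v) :
  funny_elim_arr (comp (funny C D) p q)
  = comp E (funny_elim_arr p) (funny_elim_arr q).
Proof. by rewrite -(frepK p) -(frepK q) /= funny_compE !funny_elim_cls. Qed.

Definition funny_elim : functor (funny C D) E :=
  Functor funny_elim_id funny_elim_comp.

Lemma amap_funny_elim u v (t : fterm C D u v) :
  amap funny_elim (Arr (C := funny C D) (fcls t)) = Arr (fterm_elim t).
Proof. by rewrite /amap /= funny_elim_cls. Qed.

End FunnyElim.

Section FunnyInjections.
Variables (S T : Type) (C : category S) (D : category T).

Fact finl_functor_id d c :
  fcls (finl D (idm C c) d) = idm (funny C D) (c, d).
Proof. exact/fclsP/frel_inl_id. Qed.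

Fact finl_functor_comp d c1 c2 c3 (g : hom C c2 c3) (f : hom C c1 c2) :
  fcls (finl D (comp C g f) d)
  = comp (funny C D) (fcls (finl D g d)) (fcls (finl D f d)).
Proof. by rewrite /= funny_compE; apply/esym/fclsP/frel_inl_comp. Qed.

Definition finl_functor d : functor C (funny C D) :=
  @Functor _ _ C (funny C D) (fun c => (c, d)) (fun _ _ f => fcls (finl D f d))
    (finl_functor_id d) (finl_functor_comp d).

Fact finr_functor_id c d :
  fcls (finr C c (idm D d)) = idm (funny C D) (c, d).
Proof. exact/fclsP/frel_inr_id. Qed.

Fact finr_functor_comp c d1 d2 d3 (g : hom D d2 d3) (f : hom D d1 d2) :
  fcls (finr C c (comp D g f))
  = comp (funny C D) (fcls (finr C c g)) (fcls (finr C c f)).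
Proof. by rewrite /= funny_compE; apply/esym/fclsP/frel_inr_comp. Qed.

Definition finr_functor c : functor D (funny C D) :=
  @Functor _ _ D (funny C D) (fun d => (c, d)) (fun _ _ g => fcls (finr C c g))
    (finr_functor_id c) (finr_functor_comp c).

End FunnyInjections.

Section FunnyStructure.
Variables (S T U : Type) (C : category S) (D : category T) (E : category U).

Definition funny_swap : functor (funny C D) (funny D C) :=
  @funny_elim _ _ _ C D (funny D C) (fun u => (u.2, u.1))
    (fun _ _ f d => farr (finr_functor D C d) f)
    (fun c _ _ g => farr (finl_functor D C c) g)
    (fun c d => farr_id (finr_functor D C d) c)
    (fun c d => farr_id (finl_functor D C c) d)
    (fun _ _ _ _ _ d => farr_comp (finr_functor D C d) _ _)
    (fun c _ _ _ _ _ => farr_comp (finl_functor D C c) _ _).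

Definition funny_proj2 : functor (funny C D) D :=
  @funny_elim _ _ _ C D D snd (fun _ _ _ d => idm D d) (fun _ _ _ g => g)
    (fun _ _ => erefl) (fun _ _ => erefl)
    (fun _ _ _ _ _ _ => esym (comp_idl _)) (fun _ _ _ _ _ _ => erefl).

(** The restriction of the associator to a fixed object z of the third factor.
    An arrow of C [] D is not itself a generator of C [] (D [] E), so the
    associator needs two nested eliminations. *)
Definition funny_assocl (z : U) : functor (funny C D) (funny C (funny D E)) :=
  @funny_elim _ _ _ C D (funny C (funny D E)) (fun u => (u.1, (u.2, z)))
    (fun _ _ f d => farr (finl_functor C (funny D E) (d, z)) f)
    (fun c _ _ g => farr (finr_functor C (funny D E) c)
                      (farr (finl_functor D E z) g))
    (fun c d => farr_id (finl_functor C (funny D E) (d, z)) c)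
    (fun c d => farr_id (functor_comp (finr_functor C _ c) (finl_functor D E z)) d)
    (fun _ _ _ _ _ d => farr_comp (finl_functor C (funny D E) (d, z)) _ _)
    (fun c _ _ _ _ _ =>
       farr_comp (functor_comp (finr_functor C _ c) (finl_functor D E z)) _ _).

Definition funny_assoc :
    functor (funny (funny C D) E) (funny C (funny D E)) :=
  @funny_elim _ _ _ (funny C D) E (funny C (funny D E))
    (fun u => (u.1.1, (u.1.2, u.2)))
    (fun _ _ p z => farr (funny_assocl z) p)
    (fun u _ _ h => farr (finr_functor C (funny D E) u.1)
                      (farr (finr_functor D E u.2) h))
    (fun u z => farr_id (funny_assocl z) u)
    (fun u z => farr_id (functor_comp (finr_functor C _ u.1)
                                      (finr_functor D E u.2)) z)
    (fun _ _ _ _ _ z => farr_comp (funny_assocl z) _ _)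
    (fun u _ _ _ _ _ =>
       farr_comp (functor_comp (finr_functor C _ u.1) (finr_functor D E u.2)) _ _).

End FunnyStructure.

Section AmapFunny.
Variables (S T : Type) (C : category S) (D : category T).

Definition ainl (p : arr C) (d : T) : arr (funny C D) :=
  amap (finl_functor C D d) p.

Definition ainr (c : S) (q : arr D) : arr (funny C D) :=
  amap (finr_functor C D c) q.

Lemma amap_proj2_inl p d : amap (funny_proj2 C D) (ainl p d) = Arr (idm D d).
Proof. exact: amap_funny_elim. Qed.

Lemma amap_proj2_inr c q : amap (funny_proj2 C D) (ainr c q) = q.
Proof. by case: q => a b g; apply: amap_funny_elim. Qed.

End AmapFunny.
Arguments ainl {S T C D} p d.
Arguments ainr {S T C D} c q.

Section AmapFunnyStructure.
Variables (S T U : Type) (C : category S) (D : category T) (E : category U).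

Lemma amap_swap_inl (p : arr C) (d : T) :
  amap (funny_swap C D) (ainl p d) = ainr d p.
Proof. exact: amap_funny_elim. Qed.

Lemma amap_swap_inr (c : S) (q : arr D) :
  amap (funny_swap C D) (ainr c q) = ainl q c.
Proof. exact: amap_funny_elim. Qed.

(** A generator nested in a generator: each of the two eliminations computes
    once. *)
Lemma amap_assoc_inl_inl (p : arr C) (d : T) (z : U) :
  amap (funny_assoc C D E) (ainl (ainl p d) z) = ainl p (d, z).
Proof. by apply: etrans; exact: amap_funny_elim. Qed.

Lemma amap_assoc_inl_inr (c : S) (q : arr D) (z : U) :
  amap (funny_assoc C D E) (ainl (ainr c q) z) = ainr c (ainl q z).
Proof. by apply: etrans; exact: amap_funny_elim. Qed.

Lemma amap_assoc_inr (u : S * T) (h : arr E) :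
  amap (funny_assoc C D E) (ainr u h) = ainr u.1 (ainr u.2 h).
Proof. by case: u => c d; apply: amap_funny_elim. Qed.

End AmapFunnyStructure.

Section AmapFunnyMap.
Variables (S T S' T' : Type) (C : category S) (D : category T).
Variables (C' : category S') (D' : category T').
Variables (F : functor C C') (G : functor D D').

Lemma amap_map_inl p d : amap (funny_map F G) (ainl p d) = ainl (amap F p) (G d).
Proof. by rewrite /amap /= funny_arrE. Qed.

Lemma amap_map_inr c q : amap (funny_map F G) (ainr c q) = ainr (F c) (amap G q).
Proof. by rewrite /amap /= funny_arrE. Qed.

End AmapFunnyMap.

(** * Arrows in the fibres of a disk *)

Section DiskArrows.
Variables (n : nat) (j k : 'I_n.+1) (e : k = j.+1 :> nat).
Implicit Types X Y Z : gdisk n.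

(** One type for all the fibres, so that arrows over points that are only
    propositionally equal can be compared. *)
Record darr X := DArr { abase : lev X j; aarr : arr (fib X e abase) }.

Lemma DArr_inj X x (p q : arr (fib X e x)) : DArr p = DArr q -> p = q.
Proof.
have cast (s t : darr X) : s = t -> exists ex : abase s = abase t,
    ecast x (arr (fib X e x)) ex (aarr s) = aarr t.
  by move=> ->; exists erefl.
by move=> /cast [/= ex <-]; rewrite (Prop_irrelevance ex erefl).
Qed.

Definition did X (a : lev X k) : darr X :=
  @DArr X (dn X e a) (Arr (idm (fib X e (dn X e a)) (exist _ a erefl))).

Lemma didE X x (a : fibre (dn X e) x) :
  DArr (Arr (idm (fib X e x) a)) = did (sval a).
Proof. by case: a => a ax; case: _ / ax. Qed.

(** Composition is a relation, since two arrows of [darr X] need not be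
    composable. *)
Inductive dcomp X : darr X -> darr X -> darr X -> Prop :=
  DComp x a b c (g : hom (fib X e x) b c) (f : hom (fib X e x) a b) :
    dcomp (DArr (Arr g)) (DArr (Arr f)) (DArr (Arr (comp _ g f))).

(** Makes the set of arrows on which two functorial maps agree closed under
    composition. *)
Lemma dcomp_uniq X (q p r r' : darr X) : dcomp q p r -> dcomp q p r' -> r = r'.
Proof.
case=> x a b c g f H.
suff K q' p' : dcomp q' p' r' -> DArr (Arr g) = q' -> DArr (Arr f) = p' ->
  DArr (Arr (comp _ g f)) = r' by apply: K H erefl erefl.
case=> x' a' b' c' g' f' eg; have ex := congr1 (@abase X) eg.
rewrite /= in ex; move: a' b' c' g' f' eg.
case: x' / ex => a' b' c' g' f' /DArr_inj eg.
move=> /DArr_inj ef.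
have eb := congr1 (@asrc _ _) eg; have ec := congr1 (@atgt _ _) eg.
have ea := congr1 (@asrc _ _) ef; rewrite /= in ea eb ec.
move: g' f' eg ef; case: b' / eb; case: c' / ec; case: a' / ea.
by move=> g' f' eg ef; rewrite (Arr_inj eg) (Arr_inj ef).
Qed.

Record functorial X Y (o : lev X k -> lev Y k) (F : darr X -> darr Y) : Prop :=
  Functorial {
    functorial_id : forall a, F (did a) = did (o a);
    functorial_comp : forall q p r, dcomp q p r -> dcomp (F q) (F p) (F r) }.

Lemma comp_functorial X Y Z (o : lev X k -> lev Y k) F (o' : lev Y k -> lev Z k) F' :
  functorial o' F' -> functorial o F -> functorial (o' \o o) (F' \o F).
Proof.
move=> [i' c'] [i c]; split=> [a|q p r h]; first by rewrite /= i i'.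
by apply: c'; apply: c.
Qed.

Definition dmap X Y (f : gdisk_hom X Y) (p : darr X) : darr Y :=
  DArr (amap (fmap f e (abase p)) (aarr p)).

Lemma dmap_functorial X Y (f : gdisk_hom X Y) : functorial (@lmap _ _ _ f k) (dmap f).
Proof.
split=> [a|_ _ _ [x a b c g h]]; first by rewrite /dmap /amap /= farr_id didE fmapE.
by rewrite /dmap /amap /= farr_comp; apply: DComp.
Qed.

Lemma dmap_did X Y (f : gdisk_hom X Y) a : dmap f (did a) = did (lmap f a).
Proof. exact: functorial_id (dmap_functorial f) a. Qed.

Lemma dmap_comp X Y Z (g : gdisk_hom Y Z) (f : gdisk_hom X Y) p :
  dmap (gdisk_comp g f) p = dmap g (dmap f p).
Proof. by []. Qed.

Lemma dmap_id X p : dmap (gdisk_id X) p = p.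
Proof. by case: p => x [a b f]. Qed.

Section FunnyArrows.
Variables X Y : gdisk n.

(** The identification of the fibre over (x, y) with the funny product of the
    fibres over x and y, on arrows. *)
Definition djoin x y (p : arr (funny (fib X e x) (fib Y e y))) :
    darr (funny_disk X Y) :=
  @DArr (funny_disk X Y) (x, y)
    (amap (unpull_functor (funny (fib X e x) (fib Y e y))
       (@fib_pairK _ _ _ _ (dn X e) (dn Y e) (x, y))) p).

(** The generators p [] id_b and id_a [] q.  The base point of b is recovered
    as dn b, so that b ranges over a plain level and not over a fibre; this is
    what lets these formulas be iterated without casts. *)
Definition dinl (p : darr X) (b : lev Y k) : darr (funny_disk X Y) :=
  @djoin (abase p) (dn Y e b) (ainl (aarr p) (exist _ b erefl)).

Definition dinr (a : lev X k) (q : darr Y) : darr (funny_disk X Y) :=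
  @djoin (dn X e a) (abase q) (ainr (exist _ a erefl) (aarr q)).

Lemma djoin_inl x y p (b : fibre (dn Y e) y) :
  @djoin x y (ainl p b) = dinl (DArr p) (sval b).
Proof. by case: b => b yE; case: _ / yE. Qed.

Lemma djoin_inr x y (a : fibre (dn X e) x) q :
  @djoin x y (ainr a q) = dinr (sval a) (DArr q).
Proof. by case: a => a xE; case: _ / xE. Qed.

Lemma djoin_id x y u :
  @djoin x y (Arr (idm (funny (fib X e x) (fib Y e y)) u))
  = did (X := funny_disk X Y) (sval u.1, sval u.2).
Proof.
rewrite /djoin /amap /ahom farr_id.
exact: (@didE (funny_disk X Y) (x, y) (fib_pair (u := (x, y)) u)).
Qed.

Lemma djoin_comp x y u v w (g : hom (funny (fib X e x) (fib Y e y)) v w)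
    (f : hom (funny (fib X e x) (fib Y e y)) u v) :
  dcomp (djoin (Arr g)) (djoin (Arr f)) (djoin (Arr (comp _ g f))).
Proof. by rewrite /djoin /amap /ahom farr_comp; apply: DComp. Qed.

Lemma djoin_surj (r : darr (funny_disk X Y)) : exists x y p, r = @djoin x y p.
Proof.
case: r => -[x y] p; exists x, y, (amap (pull_functor _ _) p).
by rewrite /djoin amap_pullK //; apply: fib_splitK.
Qed.

Lemma dinl_functorial b : functorial (Y := funny_disk X Y) (fun a => (a, b)) (dinl^~ b).
Proof.
split=> [a|_ _ _ [x a b' c g h]]; first by rewrite /dinl /ainl /amap farr_id djoin_id.
by rewrite /dinl /ainl /amap /ahom farr_comp; apply: djoin_comp.
Qed.

Lemma dinr_functorial a : functorial (Y := funny_disk X Y) (fun b => (a, b)) (dinr a).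
Proof.
split=> [b|_ _ _ [x a' b c g h]]; first by rewrite /dinr /ainr /amap farr_id djoin_id.
by rewrite /dinr /ainr /amap /ahom farr_comp; apply: djoin_comp.
Qed.

(** The arrows of a fibre of a funny product are generated by [dinl] and
    [dinr]: induction on a representing term. *)
Lemma funny_darr_ext Z o o' (F G : darr (funny_disk X Y) -> darr Z) :
  functorial o F -> functorial o' G -> o =1 o' ->
  (forall p b, F (dinl p b) = G (dinl p b)) ->
  (forall a q, F (dinr a q) = G (dinr a q)) ->
  F =1 G.
Proof.
move=> [Fi Fc] [Gi Gc] oo' Hl Hr r; have [x [y [[u v p] ->]]] := djoin_surj r.
rewrite -[p]frepK; elim: (frep p) => {u v p}.
- by move=> u; rewrite (djoin_id u) Fi Gi oo'.
- move=> u v w t IHt s IHs; rewrite -funny_compE.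
  have H := djoin_comp (fcls t) (fcls s).
  have := Gc _ _ _ H; rewrite -IHt -IHs; exact: dcomp_uniq (Fc _ _ _ H).
- by move=> c1 c2 f d; rewrite (djoin_inl (Arr f) d).
- by move=> c d1 d2 g; rewrite (djoin_inr c (Arr g)).
Qed.

End FunnyArrows.

End DiskArrows.
Arguments dinl {n j k e X Y} p b.
Arguments dinr {n j k e X Y} a q.
Arguments djoin {n j k e X Y} x y p.
Arguments did {n j k e X} a.
Arguments dmap {n j k e X Y} f p.

(** Reduces equality of homs, whose fibre functors have types depending on the
    level maps, to equality of two non-dependent functions. *)
Lemma gdisk_hom_ext n (X Y : gdisk n) (f g : gdisk_hom X Y) :
  (forall k (x : lev X k), lmap f x = lmap g x) ->
  (forall (j k : 'I_n.+1) (e : k = j.+1 :> nat) (p : darr e X),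
     dmap f p = dmap g p) ->
  f = g.
Proof.
case: f => l d s t F FE; case: g => l' d' s' t' G GE /= ll' FG.
have El : l = l' by apply: functional_extensionality_dep => k; apply: funext.
move: d' s' t' G GE FG {ll'}; case: l' / El => d' s' t' G GE FG.
apply: gdisk_hom_eq => j k e x.
have {}FG (p : arr (fib X e x)) : amap (F j k e x) p = amap (G j k e x) p.
  exact: DArr_inj (FG j k e (DArr p)).
move: (F j k e x) (G j k e x) FG => [o r p q] [o' r' p' q'] FG.
have Eo : o = o' by apply: funext => a; have := congr1 (@asrc _ _) (FG (Arr (idm _ a))).
case: o' / Eo r' p' q' FG => r' p' q' FG.
have Er : r = r'.
  do 3![apply: functional_extensionality_dep => ?].
  exact: Arr_inj (FG (Arr _)).
case: r' / Er p' q' {FG} => p' q'; exact: functor_eq.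
Qed.

(** * Homs out of a funny product of disks *)

(** The iterated versions apply [funny_darr_ext] to composites such as
    p |-> dmap f (dinl p c), which are again functorial. *)
Section GenExt.
Variable n : nat.
Implicit Types X Y Z W V : gdisk n.

Lemma funny_hom_ext X Y W (f g : gdisk_hom (funny_disk X Y) W) :
  (forall k (u : lev (funny_disk X Y) k), lmap f u = lmap g u) ->
  (forall (j k : 'I_n.+1) (e : k = j.+1 :> nat) (p : darr e X) b,
     dmap f (dinl p b) = dmap g (dinl p b)) ->
  (forall (j k : 'I_n.+1) (e : k = j.+1 :> nat) a (q : darr e Y),
     dmap f (dinr a q) = dmap g (dinr a q)) ->
  f = g.
Proof.
move=> fg Hl Hr; apply: gdisk_hom_ext => // j k e.
by apply: (funny_darr_ext (dmap_functorial e f) (dmap_functorial e g)).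
Qed.

Lemma funny_hom_ext_l X Y Z W (f g : gdisk_hom (funny_disk (funny_disk X Y) Z) W) :
  (forall k (u : lev (funny_disk (funny_disk X Y) Z) k), lmap f u = lmap g u) ->
  (forall (j k : 'I_n.+1) (e : k = j.+1 :> nat) (p : darr e X) b c,
     dmap f (dinl (dinl p b) c) = dmap g (dinl (dinl p b) c)) ->
  (forall (j k : 'I_n.+1) (e : k = j.+1 :> nat) a (q : darr e Y) c,
     dmap f (dinl (dinr a q) c) = dmap g (dinl (dinr a q) c)) ->
  (forall (j k : 'I_n.+1) (e : k = j.+1 :> nat) u (r : darr e Z),
     dmap f (dinr u r) = dmap g (dinr u r)) ->
  f = g.
Proof.
move=> fg Hll Hlr Hr; apply: funny_hom_ext => // j k e p c.
have F h := comp_functorial (Z := W) (dmap_functorial e h)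
  (dinl_functorial e (funny_disk X Y) (Y := _) c).
apply: (funny_darr_ext (F f) (F g)) => //.
- by move=> a; apply: fg.
- by move=> q b; apply: Hll.
- by move=> a q; apply: Hlr.
Qed.

Lemma funny_hom_ext_r X Y Z W (f g : gdisk_hom (funny_disk X (funny_disk Y Z)) W) :
  (forall k (u : lev (funny_disk X (funny_disk Y Z)) k), lmap f u = lmap g u) ->
  (forall (j k : 'I_n.+1) (e : k = j.+1 :> nat) (p : darr e X) u,
     dmap f (dinl p u) = dmap g (dinl p u)) ->
  (forall (j k : 'I_n.+1) (e : k = j.+1 :> nat) a (q : darr e Y) c,
     dmap f (dinr a (dinl q c)) = dmap g (dinr a (dinl q c))) ->
  (forall (j k : 'I_n.+1) (e : k = j.+1 :> nat) a b (r : darr e Z),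
     dmap f (dinr a (dinr b r)) = dmap g (dinr a (dinr b r))) ->
  f = g.
Proof.
move=> fg Hl Hrl Hrr; apply: funny_hom_ext => // j k e a p.
have F h := comp_functorial (Z := W) (dmap_functorial e h)
  (dinr_functorial e (X := _) (funny_disk Y Z) a).
apply: (funny_darr_ext (F f) (F g)) => //.
- by move=> b; apply: fg.
- by move=> q b; apply: Hrl.
- by move=> b q; apply: Hrr.
Qed.

Lemma funny_hom_ext_ll X Y Z V W
    (f g : gdisk_hom (funny_disk (funny_disk (funny_disk X Y) Z) V) W) :
  (forall k (u : lev (funny_disk (funny_disk (funny_disk X Y) Z) V) k),
     lmap f u = lmap g u) ->
  (forall (j k : 'I_n.+1) (e : k = j.+1 :> nat) (p : darr e X) b c d,
     dmap f (dinl (dinl (dinl p b) c) d) = dmap g (dinl (dinl (dinl p b) c) d)) ->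
  (forall (j k : 'I_n.+1) (e : k = j.+1 :> nat) a (q : darr e Y) c d,
     dmap f (dinl (dinl (dinr a q) c) d) = dmap g (dinl (dinl (dinr a q) c) d)) ->
  (forall (j k : 'I_n.+1) (e : k = j.+1 :> nat) u (r : darr e Z) d,
     dmap f (dinl (dinr u r) d) = dmap g (dinl (dinr u r) d)) ->
  (forall (j k : 'I_n.+1) (e : k = j.+1 :> nat) u (s : darr e V),
     dmap f (dinr u s) = dmap g (dinr u s)) ->
  f = g.
Proof.
move=> fg Hlll Hllr Hlr Hr; apply: funny_hom_ext_l => // j k e p c d.
have F h := comp_functorial (Z := W) (dmap_functorial e h)
  (comp_functorial (dinl_functorial e (funny_disk (funny_disk X Y) Z) (Y := _) d)
                   (dinl_functorial e (funny_disk X Y) (Y := _) c)).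
apply: (funny_darr_ext (F f) (F g)) => //.
- by move=> a; apply: fg.
- by move=> q b; apply: Hlll.
- by move=> a q; apply: Hllr.
Qed.

End GenExt.

Section DmapFunny.
Variables (n : nat) (j k : 'I_n.+1) (e : k = j.+1 :> nat).
Variables (X X' Y Y' : gdisk n) (f : gdisk_hom X X') (g : gdisk_hom Y Y').

Lemma dmap_funny_hom x y p :
  dmap (funny_hom f g) (djoin (e := e) x y p)
  = djoin (lmap f x) (lmap g y) (amap (funny_map (fmap f e x) (fmap g e y)) p).
Proof.
by rewrite -{2}(amap_unpullK (@fib_pairK _ _ _ _ (dn X e) (dn Y e) (x, y)) p).
Qed.

Lemma dmap_funny_inl (p : darr e X) b :
  dmap (funny_hom f g) (dinl p b) = dinl (dmap f p) (lmap g b).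
Proof. by rewrite dmap_funny_hom amap_map_inl djoin_inl fmapE. Qed.

Lemma dmap_funny_inr a (q : darr e Y) :
  dmap (funny_hom f g) (dinr a q) = dinr (lmap f a) (dmap g q).
Proof. by rewrite dmap_funny_hom amap_map_inr djoin_inr fmapE. Qed.

End DmapFunny.

(** Homs out of a funny product are given by functors out of the funny products
    of fibres.  Stated for these rather than for the transported fibres, so that
    the structure maps of categories can be plugged in directly. *)
Section FunnyRec.
Variables (n : nat) (X Y Z : gdisk n).
Variable l : forall k : 'I_n.+1, lev (funny_disk X Y) k -> lev Z k.
Hypothesis l_dn : forall (j k : 'I_n.+1) (e : k = j.+1 :> nat) u,
  l (dn (funny_disk X Y) e u) = dn Z e (l u).
Hypothesis l_src : forall (j k : 'I_n.+1) (e : k = j.+1 :> nat) u,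
  l (src (funny_disk X Y) e u) = src Z e (l u).
Hypothesis l_tgt : forall (j k : 'I_n.+1) (e : k = j.+1 :> nat) u,
  l (tgt (funny_disk X Y) e u) = tgt Z e (l u).
Variable H : forall (j k : 'I_n.+1) (e : k = j.+1 :> nat) (u : lev (funny_disk X Y) j),
  functor (funny (fib X e u.1) (fib Y e u.2)) (fib Z e (l u)).
Hypothesis H_ob : forall (j k : 'I_n.+1) (e : k = j.+1 :> nat) u a,
  sval (H e u a) = l (sval a.1, sval a.2).

Fact funny_rec_fmapE (j k : 'I_n.+1) (e : k = j.+1 :> nat) u
    (a : fibre (dn (funny_disk X Y) e) u) :
  sval (functor_comp (H e u) (pull_functor _ (@fib_split _ _ _ _ _ _ u)) a)
  = l (sval a).
Proof. by rewrite /= H_ob /=; case: a => -[]. Qed.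

Definition funny_rec : gdisk_hom (funny_disk X Y) Z :=
  GDiskHom l_dn l_src l_tgt funny_rec_fmapE.

Lemma dmap_rec (j k : 'I_n.+1) (e : k = j.+1 :> nat) x y p :
  dmap funny_rec (djoin (e := e) x y p) = DArr (amap (H e (x, y)) p).
Proof.
by rewrite -{2}(amap_unpullK (@fib_pairK _ _ _ _ (dn X e) (dn Y e) (x, y)) p).
Qed.

End FunnyRec.

(** * The structure maps *)

Section Braid.
Variables (n : nat) (X Y : gdisk n).

Definition braid_hom : gdisk_hom (funny_disk X Y) (funny_disk Y X) :=
  @funny_rec n X Y (funny_disk Y X) (fun _ u => (u.2, u.1))
    (fun _ _ _ _ => erefl) (fun _ _ _ _ => erefl) (fun _ _ _ _ => erefl)
    (fun _ _ e u => functor_comp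
      (unpull_functor _ (@fib_pairK _ _ _ _ (dn Y e) (dn X e) (u.2, u.1)))
      (funny_swap (fib X e u.1) (fib Y e u.2)))
    (fun _ _ _ _ _ => erefl).

Variables (j k : 'I_n.+1) (e : k = j.+1 :> nat).

Lemma dmap_braid_inl (p : darr e X) b : dmap braid_hom (dinl p b) = dinr b p.
Proof. by rewrite dmap_rec amap_functor_comp amap_swap_inl. Qed.

Lemma dmap_braid_inr a (q : darr e Y) : dmap braid_hom (dinr a q) = dinl q a.
Proof. by rewrite dmap_rec amap_functor_comp amap_swap_inr. Qed.

End Braid.

(** The projection exists for any X: forgetting the arrows of the first factor
    respects the relations of the funny product.  Its case of interest is the
    degenerate X. *)
Section Proj2.
Variables (n : nat) (X Y : gdisk n).

Definition proj2_hom : gdisk_hom (funny_disk X Y) Y :=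
  @funny_rec n X Y Y (fun _ u => u.2)
    (fun _ _ _ _ => erefl) (fun _ _ _ _ => erefl) (fun _ _ _ _ => erefl)
    (fun _ _ e u => funny_proj2 (fib X e u.1) (fib Y e u.2))
    (fun _ _ _ _ _ => erefl).

Variables (j k : 'I_n.+1) (e : k = j.+1 :> nat).

Lemma dmap_proj2_inl (p : darr e X) b : dmap proj2_hom (dinl p b) = did b.
Proof. by rewrite dmap_rec amap_proj2_inl. Qed.

Lemma dmap_proj2_inr a (q : darr e Y) : dmap proj2_hom (dinr a q) = q.
Proof. by rewrite dmap_rec amap_proj2_inr; case: q. Qed.

End Proj2.

Section UnitInsertion.
Variables (n : nat) (X : gdisk n).
Let I := degenerate n.

Definition unit_insert : gdisk_hom X (funny_disk I X) :=
  @GDiskHom n X (funny_disk I X) (fun _ x => (tt, x))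
    (fun _ _ _ _ => erefl) (fun _ _ _ _ => erefl) (fun _ _ _ _ => erefl)
    (fun _ _ e x => functor_comp
      (unpull_functor (funny (fib I e tt) (fib X e x))
        (@fib_pairK _ _ _ _ (dn I e) (dn X e) (tt, x)))
      (finr_functor (fib I e tt) (fib X e x) (exist _ tt erefl)))
    (fun _ _ _ _ _ => erefl).

Variables (j k : 'I_n.+1) (e : k = j.+1 :> nat).

Lemma dmap_unit_insert (p : darr e X) :
  dmap unit_insert p = dinr (X := I) (tt : lev I k) p.
Proof. by []. Qed.

(** The reason why the degenerate disk is a unit: its fibre arrows contribute no
    generators besides identities. *)
Lemma degenerate_did (p : darr e I) (a : lev I k) : p = did a.
Proof.
case: p a => -[[[[] ea] [[] eb] f]] []; case: f.
rewrite (Prop_irrelevance ea eb) -(@didE n j k e I tt (exist _ tt eb)).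
by [].
Qed.

End UnitInsertion.

Section Assoc.
Variables (n : nat) (X Y Z : gdisk n).
Let P := funny_disk X (funny_disk Y Z).

(** The associator of the fibre categories, conjugated with the bijections
    between fibres over pairs and pairs of fibres: one nested in the left factor
    of the source, one in the right factor of the target, and the outer one of
    the target. *)
Definition assoc_fmap (j k : 'I_n.+1) (e : k = j.+1 :> nat)
    (u : lev (funny_disk (funny_disk X Y) Z) j) :
    functor (funny (fib (funny_disk X Y) e u.1) (fib Z e u.2))
      (fib P e (u.1.1, (u.1.2, u.2))) :=
  functor_comp
    (unpull_functor (funny (fib X e u.1.1) (fib (funny_disk Y Z) e (u.1.2, u.2)))
       (@fib_pairK _ _ _ _ (dn X e) (dn (funny_disk Y Z) e) (u.1.1, (u.1.2, u.2))))
  (functor_comp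
    (funny_map (functor_id (fib X e u.1.1))
       (unpull_functor (funny (fib Y e u.1.2) (fib Z e u.2))
         (@fib_pairK _ _ _ _ (dn Y e) (dn Z e) (u.1.2, u.2))))
  (functor_comp
    (funny_assoc (fib X e u.1.1) (fib Y e u.1.2) (fib Z e u.2))
    (funny_map (pull_functor (funny (fib X e u.1.1) (fib Y e u.1.2))
                 (@fib_split _ _ _ _ (dn X e) (dn Y e) u.1))
      (functor_id (fib Z e u.2))))).

Definition assoc_hom : gdisk_hom (funny_disk (funny_disk X Y) Z) P :=
  @funny_rec n (funny_disk X Y) Z P (fun _ u => (u.1.1, (u.1.2, u.2)))
    (fun _ _ _ _ => erefl) (fun _ _ _ _ => erefl) (fun _ _ _ _ => erefl)
    assoc_fmap (fun _ _ _ _ _ => erefl).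

Variables (j k : 'I_n.+1) (e : k = j.+1 :> nat).

Lemma dmap_assoc_inl_inl (p : darr e X) b c :
  dmap assoc_hom (dinl (dinl p b) c) = dinl p ((b, c) : lev (funny_disk Y Z) k).
Proof.
rewrite dmap_rec /assoc_fmap !amap_functor_comp amap_map_inl.
rewrite [amap (pull_functor _ _) _]amap_unpullK amap_assoc_inl_inl.
rewrite amap_map_inl amap_functor_id; case: p => x p.
exact: (djoin_inl (Y := funny_disk Y Z)).
Qed.

Lemma dmap_assoc_inl_inr a (q : darr e Y) c :
  dmap assoc_hom (dinl (dinr a q) c) = dinr a (dinl q c).
Proof.
rewrite dmap_rec /assoc_fmap !amap_functor_comp amap_map_inl.
rewrite [amap (pull_functor _ _) _]amap_unpullK amap_assoc_inl_inr.
by rewrite amap_map_inr.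
Qed.

Lemma dmap_assoc_inr (u : lev (funny_disk X Y) k) (r : darr e Z) :
  dmap assoc_hom (dinr u r) = dinr u.1 (dinr u.2 r).
Proof.
rewrite dmap_rec /assoc_fmap !amap_functor_comp amap_map_inr amap_functor_id.
rewrite amap_assoc_inr amap_map_inr; case: u => a b; case: r => z r.
apply: etrans (djoin_inr (Y := funny_disk Y Z) _ _) _.
by congr dinr.
Qed.

End Assoc.

Definition dmapE := (dmap_comp, dmap_id, dmap_did, dmap_funny_inl, dmap_funny_inr,
  dmap_braid_inl, dmap_braid_inr, dmap_proj2_inl, dmap_proj2_inr, dmap_unit_insert,
  dmap_assoc_inl_inl, dmap_assoc_inl_inr, dmap_assoc_inr).

Lemma dinl_did n (j k : 'I_n.+1) (e : k = j.+1 :> nat) (X Y : gdisk n) a b :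
  dinl (e := e) (did (X := X) a) b = did (X := funny_disk X Y) (a, b).
Proof. exact: functorial_id (dinl_functorial e X b) a. Qed.

Lemma dinr_did n (j k : 'I_n.+1) (e : k = j.+1 :> nat) (X Y : gdisk n) a b :
  dinr (e := e) a (did (X := Y) b) = did (X := funny_disk X Y) (a, b).
Proof. exact: functorial_id (dinr_functorial e Y a) b. Qed.

(** * Invertibility, naturality and coherence *)

Section Monoidal.
Variable n : nat.
Implicit Types X Y Z W : gdisk n.

Lemma braidK X Y :
  gdisk_comp (braid_hom Y X) (braid_hom X Y) = gdisk_id (funny_disk X Y).
Proof. by apply: funny_hom_ext => [k []|*|*] //; rewrite !dmapE. Qed.

(** The associator (Z Y) X -> Z (Y X) between two reversals of the order of the
    factors, X (Y Z) -> (Z Y) X and Z (Y X) -> (X Y) Z, built from braidings. *)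
Definition assoc_inv X Y Z :
    gdisk_hom (funny_disk X (funny_disk Y Z)) (funny_disk (funny_disk X Y) Z) :=
  gdisk_comp (funny_hom (braid_hom Y X) (gdisk_id Z))
  (gdisk_comp (braid_hom Z (funny_disk Y X))
  (gdisk_comp (assoc_hom Z Y X)
  (gdisk_comp (funny_hom (braid_hom Y Z) (gdisk_id X))
              (braid_hom X (funny_disk Y Z))))).

Lemma assocK X Y Z : gdisk_comp (assoc_inv X Y Z) (assoc_hom X Y Z) = gdisk_id _.
Proof.
by apply: funny_hom_ext_l => [k [[]]|*|*|j k e [a b] r] //; rewrite !dmapE.
Qed.

Lemma assoc_invK X Y Z : gdisk_comp (assoc_hom X Y Z) (assoc_inv X Y Z) = gdisk_id _.
Proof.
by apply: funny_hom_ext_r => [k [? []]|j k e p [b c]|*|*] //; rewrite !dmapE.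
Qed.

Definition lunit_hom X : gdisk_hom (funny_disk (degenerate n) X) X :=
  proj2_hom (degenerate n) X.

Definition runit_hom X : gdisk_hom (funny_disk X (degenerate n)) X :=
  gdisk_comp (lunit_hom X) (braid_hom X (degenerate n)).

Lemma lunitK X : gdisk_comp (unit_insert X) (lunit_hom X) = gdisk_id _.
Proof.
apply: funny_hom_ext => [k [[] x]|j k e p b|j k e [] q] //; rewrite !dmapE //.
by rewrite (degenerate_did p (tt : lev (degenerate n) k)) dinl_did dinr_did.
Qed.

Lemma lunit_insertK X : gdisk_comp (lunit_hom X) (unit_insert X) = gdisk_id X.
Proof. by apply: gdisk_hom_ext => // *; rewrite !dmapE. Qed.

Definition runit_inv X : gdisk_hom X (funny_disk X (degenerate n)) :=
  gdisk_comp (braid_hom (degenerate n) X) (unit_insert X).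

Lemma runitK X : gdisk_comp (runit_inv X) (runit_hom X) = gdisk_id _.
Proof.
apply: funny_hom_ext => [k [x []]|j k e p []|j k e a q] //; rewrite !dmapE //.
by rewrite (degenerate_did q (tt : lev (degenerate n) k)) dinl_did dinr_did.
Qed.

Lemma runit_invK X : gdisk_comp (runit_hom X) (runit_inv X) = gdisk_id X.
Proof. by apply: gdisk_hom_ext => // *; rewrite !dmapE. Qed.

Lemma funny_hom_id X Y :
  funny_hom (gdisk_id X) (gdisk_id Y) = gdisk_id (funny_disk X Y).
Proof. by apply: funny_hom_ext => [k []|*|*] //; rewrite !dmapE. Qed.

Lemma funny_hom_comp X X' X'' Y Y' Y'' (f' : gdisk_hom X' X'') (f : gdisk_hom X X')
    (g' : gdisk_hom Y' Y'') (g : gdisk_hom Y Y') :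
  funny_hom (gdisk_comp f' f) (gdisk_comp g' g)
  = gdisk_comp (funny_hom f' g') (funny_hom f g).
Proof. by apply: funny_hom_ext => // *; rewrite !dmapE. Qed.

Lemma assoc_hom_natural X X' Y Y' Z Z' (f : gdisk_hom X X') (g : gdisk_hom Y Y')
    (h : gdisk_hom Z Z') :
  gdisk_comp (assoc_hom X' Y' Z') (funny_hom (funny_hom f g) h)
  = gdisk_comp (funny_hom f (funny_hom g h)) (assoc_hom X Y Z).
Proof. by apply: funny_hom_ext_l => // *; rewrite !dmapE. Qed.

Lemma lunit_hom_natural X X' (f : gdisk_hom X X') :
  gdisk_comp (lunit_hom X') (funny_hom (gdisk_id (degenerate n)) f)
  = gdisk_comp f (lunit_hom X).
Proof. by apply: funny_hom_ext => // *; rewrite !dmapE. Qed.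

Lemma runit_hom_natural X X' (f : gdisk_hom X X') :
  gdisk_comp (runit_hom X') (funny_hom f (gdisk_id (degenerate n)))
  = gdisk_comp f (runit_hom X).
Proof. by apply: funny_hom_ext => // *; rewrite !dmapE. Qed.

Lemma braid_hom_natural X X' Y Y' (f : gdisk_hom X X') (g : gdisk_hom Y Y') :
  gdisk_comp (braid_hom X' Y') (funny_hom f g)
  = gdisk_comp (funny_hom g f) (braid_hom X Y).
Proof. by apply: funny_hom_ext => // *; rewrite !dmapE. Qed.

Lemma assoc_hom_pentagon X Y Z W :
  gdisk_comp (assoc_hom X Y (funny_disk Z W)) (assoc_hom (funny_disk X Y) Z W)
  = gdisk_comp (funny_hom (gdisk_id X) (assoc_hom Y Z W))
      (gdisk_comp (assoc_hom X (funny_disk Y Z) W)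
                  (funny_hom (assoc_hom X Y Z) (gdisk_id W))).
Proof. by apply: funny_hom_ext_ll => // *; rewrite !dmapE. Qed.

Lemma unit_triangle X Y :
  gdisk_comp (funny_hom (gdisk_id X) (lunit_hom Y)) (assoc_hom X (degenerate n) Y)
  = funny_hom (runit_hom X) (gdisk_id Y).
Proof.
apply: funny_hom_ext_l => // *; rewrite !dmapE //.
(* An arrow of the middle factor is sent to an identity by both sides, once as
   an arrow of Y and once as an arrow of X. *)
by rewrite dinl_did dinr_did.
Qed.

Lemma braid_hom_hexagon X Y Z :
  gdisk_comp (assoc_hom Y Z X)
    (gdisk_comp (braid_hom X (funny_disk Y Z)) (assoc_hom X Y Z))
  = gdisk_comp (funny_hom (gdisk_id Y) (braid_hom X Z))
      (gdisk_comp (assoc_hom Y X Z) (funny_hom (braid_hom X Y) (gdisk_id Z))).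
Proof. by apply: funny_hom_ext_l => // *; rewrite !dmapE. Qed.

Definition funny_monoidal :
    symmetric_monoidal (C := gdisk_category n) (@funny_hom n) (degenerate n) :=
  let G := gdisk_category n in
  @SymmetricMonoidal _ G _ (@funny_hom n) (degenerate n)
    funny_hom_id funny_hom_comp
    (fun X Y Z => @Iso _ G _ _ _ _ (assocK X Y Z) (assoc_invK X Y Z))
    (fun X => @Iso _ G _ _ _ _ (lunitK X) (lunit_insertK X))
    (fun X => @Iso _ G _ _ _ _ (runitK X) (runit_invK X))
    (fun X Y => @Iso _ G _ _ _ _ (braidK X Y) (braidK Y X))
    assoc_hom_natural lunit_hom_natural runit_hom_natural braid_hom_natural
    assoc_hom_pentagon unit_triangle braid_hom_hexagon braidK.

End Monoidal.

Theorem proposition1p8 (n : nat) (hn : 1 <= n) :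
  exists M : symmetric_monoidal (C := gdisk_category n)
      (@funny_hom n) (degenerate n),
    [/\ forall (X Y Z : gdisk n) k (u : lev (funny_disk (funny_disk X Y) Z) k),
          lmap (fwd (assoc M X Y Z)) u = (u.1.1, (u.1.2, u.2)),
        forall (X : gdisk n) k (u : lev (funny_disk (degenerate n) X) k),
          lmap (fwd (lunit M X)) u = u.2,
        forall (X : gdisk n) k (u : lev (funny_disk X (degenerate n)) k),
          lmap (fwd (runit M X)) u = u.1
      & forall (X Y : gdisk n) k (u : lev (funny_disk X Y) k),
          lmap (fwd (braid M X Y)) u = (u.2, u.1)].
Proof. by exists (funny_monoidal n). Qed.
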